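(* Let $T$ be a weakly o-minimal theory. Then $T$ is dp-minimal.
   Context: A theory $T$ (in a language containing a binary relation symbol $<$) is weakly o-minimal if every model of $T$ is a weakly o-minimal structure, i.e. $<$ is a linear order on the model and every subset of the model definable with parameters is a finite union of convex sets. An ICT pattern in a structure $M$ consists of a pair of formulae $\phi(x,\bar y)$, $\psi(x,\bar y)$, with $x$ a single variable and $\bar y$ a finite tuple of variables, and sequences $(\bar a_i)_{i\in\omega}$, $(\bar b_i)_{i\in\omega}$ of tuples from $M$ such that for all $i,j\in\omega$ the set $\{\phi(x,\bar a_i),\psi(x,\bar b_j)\}\cup\{\neg\phi(x,\bar a_l):l\neq i\}\cup\{\neg\psi(x,\bar b_k):k\neq j\}$ is consistent (i.e. realized in some elementary extension of $M$). A theory $T$ is dp-minimal if there is no ICT pattern in any model of $T$. *)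

(* Defs.v *)
From mathcomp Require Import all_boot.
From mathcomp Require Import classical_sets.
From Stdlib Require Import RelationClasses.

Set Implicit Arguments.
Unset Strict Implicit.
Unset Printing Implicit Defensive.

Local Open Scope classical_set_scope.

(* Symbols are indexed by their arity, so that a binary relation symbol of [L]
   is an inhabitant of [rels L 2]. *)
Record language := Language {
  funcs : nat -> Type;
  rels : nat -> Type }.

(* Variables are well-scoped de Bruijn indices: [term L n] and [formula L n]
   have their free variables among the [n] variables indexed by ['I_n]. *)
Inductive term (L : language) (n : nat) : Type :=
| Var of 'I_n
| App k of funcs L k & ('I_k -> term L n).

(* [Ex] binds variable 0 of its body, variable [i.+1] of the body being variable
   [i] outside. The other connectives and the universal quantifier are the usual
   classical abbreviations. *)
Inductive formula (L : language) : nat -> Type :=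
| Eq n of term L n & term L n : formula L n
| Rel n k of rels L k & ('I_k -> term L n) : formula L n
| Neg n of formula L n : formula L n
| And n of formula L n & formula L n : formula L n
| Ex n of formula L n.+1 : formula L n.

Definition sentence (L : language) := formula L 0.

Definition theory (L : language) := set (sentence L).

(* As usual, structures are nonempty. *)
Record structure (L : language) := Structure {
  carrier :> Type;
  carrier_inhabited : inhabited carrier;
  interp_func : forall k, funcs L k -> k.-tuple carrier -> carrier;
  interp_rel : forall k, rels L k -> k.-tuple carrier -> Prop }.

Section Semantics.
Variables (L : language) (M : structure L).

Fixpoint eval n (v : n.-tuple M) (t : term L n) : M :=
  match t with
  | Var i => tnth v i
  | App _ f ts => interp_func f [tuple eval v (ts i) | i < _]
  end.

Fixpoint sat n (phi : formula L n) : n.-tuple M -> Prop :=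
  match phi with
  | Eq _ t u => fun v => eval v t = eval v u
  | Rel _ _ R ts => fun v => interp_rel R [tuple eval v (ts i) | i < _]
  | Neg _ phi => fun v => ~ sat phi v
  | And _ phi psi => fun v => sat phi v /\ sat psi v
  | Ex _ phi => fun v => exists x : M, sat phi [tuple of x :: v]
  end.

Definition model (T : theory L) := forall phi, T phi -> sat phi [tuple].

(* A formula [phi : formula L m.+1] plays the role of [phi(x, y_1, ..., y_m)]
   with [x] variable 0; its solution set at parameters [b] is [phi(M, b)]. *)
Definition solutions m (phi : formula L m.+1) (b : m.-tuple M) : set M :=
  [set x | sat phi [tuple of x :: b]].

Definition definable (A : set M) :=
  exists m (phi : formula L m.+1) (b : m.-tuple M), A = solutions phi b.

End Semantics.

Definition elementary_embedding (L : language) (M N : structure L)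
    (f : M -> N) :=
  forall n (phi : formula L n) (v : n.-tuple M),
    sat phi v <-> sat phi (map_tuple f v).

Definition linear_order (X : Type) (lt : X -> X -> Prop) :=
  StrictOrder lt /\ forall x y, lt x y \/ x = y \/ lt y x.

Definition convex (X : Type) (lt : X -> X -> Prop) (C : set X) :=
  forall x y z, C x -> C z -> lt x y -> lt y z -> C y.

Definition finite_union_of_convex (X : Type) (lt : X -> X -> Prop)
    (A : set X) :=
  exists k (C : 'I_k -> set X),
    (forall i, convex lt (C i)) /\ A = \bigcup_i C i.

Definition weakly_ominimal (L : language) (lt : rels L 2) (M : structure L) :=
  let ltM := fun x y : M => interp_rel lt [tuple x; y] in
  linear_order ltM /\
  forall A : set M, definable A -> finite_union_of_convex ltM A.

Definition weakly_ominimal_theory (L : language) (lt : rels L 2)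
    (T : theory L) :=
  forall M : structure L, model M T -> weakly_ominimal lt M.

(* [{phi(x, a_i), psi(x, b_j)} u {~ phi(x, a_l) : l <> i}
   u {~ psi(x, b_k) : k <> j}] is realized in some elementary extension of [M];
   extensions are given up to isomorphism, by elementary embeddings. *)
Definition ict_consistent (L : language) (M : structure L) m
    (phi psi : formula L m.+1) (a b : nat -> m.-tuple M) (i j : nat) :=
  exists (N : structure L) (f : M -> N) (c : N),
    [/\ elementary_embedding f,
        solutions phi (map_tuple f (a i)) c,
        solutions psi (map_tuple f (b j)) c,
        forall l, l <> i -> ~ solutions phi (map_tuple f (a l)) c &
        forall k, k <> j -> ~ solutions psi (map_tuple f (b k)) c].

Definition ict_pattern (L : language) (M : structure L) m
    (phi psi : formula L m.+1) (a b : nat -> m.-tuple M) :=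
  forall i j, ict_consistent phi psi a b i j.

Definition dp_minimal (L : language) (T : theory L) :=
  forall M : structure L, model M T ->
    ~ exists m (phi psi : formula L m.+1) (a b : nat -> m.-tuple M),
        ict_pattern phi psi a b.

(* Main.v *)
From mathcomp Require Import all_boot.
From mathcomp Require Import boolp classical_sets filter.
Require Import Defs.

Set Implicit Arguments.
Unset Strict Implicit.
Unset Printing Implicit Defensive.

Local Open Scope classical_set_scope.

(** The reason is a count. In a weakly o-minimal theory, compactness gives for
each formula [phi(x, y)] a bound [K] such that, in every model and for every
[b], the set [phi(M, b)] is left at most [K] times along an increasing sequence
of points ([uniform_drop_bound]). Call such an exit a drop: a point in the set
followed by a larger point outside it.

Let [K] and [K'] be these bounds for the formulas [phi] and [psi] of an ICT
pattern, and let [N = K + K' + 2]. By elementarity, the part of the pattern that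
mentions only the first [N] parameters on each side is realized in [M] itself:
there are [N^2] points [c i j] such that, among the first [N] sets of each
kind, [c i j] lies in [phi(M, a_i)] and [psi(M, b_j)] and in no other
([ict_consistent_realized]). List the points in increasing order. Two
neighbours differ in [i] or in [j], so the step between them is a drop of some
[phi(M, a_i)] or some [psi(M, b_j)]. Hence the [N^2 - 1] steps are shared among
[2 N] sets that allow at most [N * (K + K') = N^2 - 2 N] drops in all, which is
absurd ([no_large_grid]).

For the bound: if there were none, pick for each [n] a model and a parameter
with more than [n] drops. In a nonprincipal ultraproduct over [n], which is
again a model of the theory by Los's theorem ([Los]), the classes of these
parameters and points give a single definable set with infinitely many drops. A
union of [k] convex sets has at most [k] drops, because two points of the same
convex set cannot have a point outside the union between them
([drops_union_of_convex]). *)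

(** * Drops along increasing sequences *)

Section Drops.
Variables (X : Type) (lt : X -> X -> Prop).

(** The interleaving is stated for all pairs, by separate comparisons between
two points: each of them passes to an ultraproduct by itself. *)
Definition drops (A : set X) (n : nat) :=
  exists y z : nat -> X,
    (forall s, s < n -> [/\ A (y s), ~ A (z s) & lt (y s) (z s)]) /\
    (forall s t, s < t < n -> lt (z s) (y t)).

(** Pigeonhole: were two of the points [y s] in the same convex piece, the point
[z s] between them would be in it too. *)
Lemma drops_union_of_convex k (C : 'I_k -> set X) n :
  (forall i, convex lt (C i)) -> drops (\bigcup_i C i) n -> n <= k.
Proof.
move=> convC [y [z [yz zy]]]; rewrite leqNgt; apply/negP => ltkn.
have /choice[g gP] : forall s : 'I_n, exists i, C i (y s).
  by move=> s; have [[i _ Ci] _ _] := yz s (ltn_ord s); exists i.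
have split_at (s t : 'I_n) : s < t -> g s <> g t.
  move=> st gst; have [_ nz ltyz] := yz s (ltn_ord s).
  apply: nz; exists (g s) => //; apply: (convC _ (y s) _ (y t)) => //.
    by rewrite gst.
  by apply: zy; rewrite st /=.
have /leq_card : injective g.
  move=> s t gst; apply/val_inj; case: (ltngtP s t) => // /split_at; congruence.
by rewrite !card_ord leqNgt ltkn.
Qed.

Hypothesis lt_order : linear_order lt.

Let ltT x y z : lt x y -> lt y z -> lt x z.
Proof. by have [[_ T] _] := lt_order; apply: T. Qed.

Lemma increasing_lt n (x : nat -> X) :
    (forall t, t < n -> lt (x t) (x t.+1)) ->
  forall s t, s < t <= n -> lt (x s) (x t).
Proof.
move=> x_lt s; elim=> [|t IH]; first by rewrite ltn0.
case/andP; rewrite ltnS leq_eqVlt => /orP[/eqP -> | st] tn; first exact: x_lt.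
by apply: (ltT (IH _)); [rewrite st ltnW | exact: x_lt].
Qed.

(** The drops along the sequence are strictly interleaved because two of them
never share a point: a drop ends outside [A] and the next one starts inside. *)
Lemma increasing_drops n (x : nat -> X) (A : set X) (D : pred nat) :
    (forall t, t < n -> lt (x t) (x t.+1)) ->
    (forall t, t < n -> D t -> A (x t) /\ ~ A (x t.+1)) ->
  drops A (count D (iota 0 n)).
Proof.
move=> x_lt xD; rewrite -size_filter; set l := [seq t <- iota 0 n | D t].
have l_lt : sorted ltn l by apply: sorted_filter (iota_ltn_sorted 0 n); exact: ltn_trans.
have lP s : s < size l -> nth 0 l s < n /\ D (nth 0 l s).
  by move=> /(mem_nth 0); rewrite mem_filter mem_iota => /and3P[].
exists (fun s => x (nth 0 l s)), (fun s => x (nth 0 l s).+1); split=> [s sl|s t /andP[st tl]].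
  by have [ltn Dn] := lP s sl; have [] := xD _ ltn Dn; split=> //; exact: x_lt.
have sl := ltn_trans st tl.
have [[sn Ds] [tn Dt]] := (lP s sl, lP t tl).
have : nth 0 l s < nth 0 l t by apply: (sorted_ltn_nth ltn_trans 0 l_lt).
rewrite leq_eqVlt => /orP[/eqP e|h]; last by apply: (increasing_lt x_lt); rewrite h ltnW.
by have [_] := xD _ sn Ds; have [+ _] := xD _ tn Dt; rewrite e.
Qed.

(** Charge each step of the sequence to one set that drops there; a set is
charged at most as often as it can drop. *)
Lemma increasing_length (I : finType) (S : I -> set X) (K : I -> nat)
    n (x : nat -> X) :
    (forall i d, drops (S i) d -> d <= K i) ->
    (forall t, t < n -> lt (x t) (x t.+1)) ->
    (forall t, t < n -> exists i, S i (x t) /\ ~ S i (x t.+1)) ->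
  n <= \sum_i K i.
Proof.
move=> SK x_lt x_drop.
(* An element of [I] is needed as the value of [g] outside the range [t < n];
   without one there is no step at all. *)
have [i0|I0] := pickP (@predT I); last first.
  by case: n x_lt x_drop => // n _ /(_ 0 isT)[i]; have := I0 i.
move=> _; have /choice[g gP] t : exists i, t < n -> S i (x t) /\ ~ S i (x t.+1).
  by case: (ltnP t n) => [/x_drop[i]|_]; [exists i | exists i0].
rewrite -[leqLHS](size_iota 0) -sum1_size (partition_big g predT) //=.
apply: leq_sum => i _; rewrite sum1_count; apply: (SK i).
by apply: increasing_drops x_lt _ => t tn /eqP <-; exact: gP.
Qed.

(** The points of the grid form an increasing sequence of [N * N - 1] steps, each
of which is a drop of some [A i] or [B j]; these sets allow only
[N * (KA + KB) = N * N - 2 * N] drops. *)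
Lemma no_large_grid (A B : nat -> set X) (KA KB : nat) (c : nat -> nat -> X) :
    let N := (KA + KB).+2 in
    (forall i d, drops (A i) d -> d <= KA) ->
    (forall j d, drops (B j) d -> d <= KB) ->
    (forall i j l, i < N -> j < N -> l < N -> A l (c i j) <-> l = i) ->
    (forall i j l, i < N -> j < N -> l < N -> B l (c i j) <-> l = j) ->
  False.
Proof.
move=> N AK BK cA cB.
pose P := ('I_N * 'I_N)%type.
pose e (p : P) := c p.1 p.2.
pose S (i : 'I_N + 'I_N) := match i with inl i => A i | inr j => B j end.
pose K (i : 'I_N + 'I_N) := if i is inl _ then KA else KB.
have SK i d : drops (S i) d -> d <= K i by case: i => i; [apply: AK | apply: BK].
have sep p q : p != q -> exists i, S i (e p) /\ ~ S i (e q).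
  case: p q => [i j] [i' j'] /eqP pq; have [ii'|/eqP ii'] := eqVneq i i'.
    exists (inr j); split; first exact/cB.
    by move/cB => /(_ (ltn_ord _) (ltn_ord _) (ltn_ord _)) /val_inj jj'; apply: pq; rewrite ii' jj'.
  exists (inl i); split; first exact/cA.
  by move/cA => /(_ (ltn_ord _) (ltn_ord _) (ltn_ord _)) /val_inj.
(* The order is pulled back to the indices, so that neighbours in the sorted
   list are known to be distinct indices. Distinct indices carry distinct
   points, hence the sorted points increase strictly. *)
pose le (p q : P) := ~~ `[< lt (e q) (e p) >].
have [[irr _] tri] := lt_order.
have le_total : total le.
  move=> p q; rewrite /le -negb_and; apply/negP => /andP[/asboolP qp /asboolP pq].
  exact: irr (ltT pq qp).
pose l := sort le (enum {: P}).
have size_l : size l = N * N by rewrite size_sort -cardE card_prod card_ord.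
have p0 : P := (ord0, ord0).
have l_neq t : t.+1 < size l -> nth p0 l t != nth p0 l t.+1.
  move=> tl; rewrite nth_uniq ?sort_uniq ?enum_uniq //; last exact: ltnW.
  by rewrite neq_ltn ltnSn.
pose x t := e (nth p0 l t).
have x_drop t : t < (N * N).-1 -> exists i, S i (x t) /\ ~ S i (x t.+1).
  by move=> tN; apply: sep; apply: l_neq; rewrite size_l.
have x_lt t : t < (N * N).-1 -> lt (x t) (x t.+1).
  move=> tN; have := sortedP p0 (sort_sorted le_total (enum {: P})) t.
  rewrite -/l size_l => /(_ tN) /asboolP.
  have [i [xi nxi]] := x_drop t tN.
  by case: (tri (x t) (x t.+1)) => [//|[xx|//]]; rewrite xx in xi.
have sumK : \sum_i K i = N * (KA + KB).
  by rewrite big_sumType /= !sum_nat_const card_ord mulnDr.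
have := increasing_length SK x_lt x_drop; rewrite sumK leqNgt.
have -> : N * N = (N * (KA + KB) + N + N).
  by rewrite -addnA addnn -muln2 -mulnDr addn2.
by rewrite -addnA !addnS -pred_Sn ltnS leq_addr.
Qed.

End Drops.

(** * Renaming of free variables *)

Section Renaming.
Variable L : language.

Fixpoint rename_term n p (r : 'I_n -> 'I_p) (t : term L n) : term L p :=
  match t with
  | Var i => Var L (r i)
  | App _ f ts => App f (fun i => rename_term r (ts i))
  end.

(** The renaming seen under a quantifier: it fixes the bound variable 0. *)
Definition rename_under n p (r : 'I_n -> 'I_p) (i : 'I_n.+1) : 'I_p.+1 :=
  if unlift ord0 i is Some j then lift ord0 (r j) else ord0.

Fixpoint rename n (phi : formula L n) : forall p, ('I_n -> 'I_p) -> formula L p :=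
  match phi in formula _ n return forall p, ('I_n -> 'I_p) -> formula L p with
  | Eq _ t u => fun _ r => Eq (rename_term r t) (rename_term r u)
  | Rel _ _ R ts => fun _ r => Rel R (fun i => rename_term r (ts i))
  | Neg _ phi => fun _ r => Neg (rename phi r)
  | And _ phi psi => fun _ r => And (rename phi r) (rename psi r)
  | Ex _ phi => fun _ r => Ex (rename phi (rename_under r))
  end.

Variable M : structure L.

Lemma eval_rename n p (r : 'I_n -> 'I_p) (v : p.-tuple M) (t : term L n) :
  eval v (rename_term r t) = eval [tuple tnth v (r i) | i < n] t.
Proof.
elim: t => [i|k f ts IH] /=; first by rewrite tnth_mktuple.
by congr interp_func; apply: eq_mktuple.
Qed.

Lemma rename_under_cons n p (r : 'I_n -> 'I_p) (v : p.-tuple M) x :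
  [tuple tnth [tuple of x :: v] (rename_under r i) | i < n.+1] =
  [tuple of x :: [tuple tnth v (r i) | i < n]].
Proof.
apply: eq_from_tnth => i; rewrite tnth_mktuple /rename_under.
by case: unliftP => [j|] ->; rewrite ?tnth0 ?tnthS ?tnth_mktuple.
Qed.

Lemma sat_rename n (phi : formula L n) p (r : 'I_n -> 'I_p) (v : p.-tuple M) :
  sat (rename phi r) v <-> sat phi [tuple tnth v (r i) | i < n].
Proof.
elim: phi p r v => {n} /= [n t u|n k R ts|n phi IH|n phi IHphi psi IHpsi|n phi IH] p r v.
- by rewrite !eval_rename.
- by under eq_mktuple do rewrite eval_rename.
- by rewrite IH.
- by rewrite IHphi IHpsi.
- by split=> -[x satx]; exists x; move: satx; rewrite IH rename_under_cons.
Qed.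

Lemma sat_rename_under n p (phi : formula L n.+1) (r : 'I_n -> 'I_p)
    (v : p.-tuple M) (w : n.-tuple M) x :
    (forall i, tnth v (r i) = tnth w i) ->
  sat (rename phi (rename_under r)) [tuple of x :: v] <->
    sat phi [tuple of x :: w].
Proof.
move=> vw; have -> : w = [tuple tnth v (r i) | i < n].
  by apply: eq_from_tnth => i; rewrite tnth_mktuple.
by rewrite sat_rename rename_under_cons.
Qed.

End Renaming.

(** * Descent along elementary embeddings *)

Section UniformConditions.
Variables (L : language) (M : structure L).

(** A subset of every structure that receives a map from [M]; this allows
one to speak at once of a set in [M] and of its counterpart in an extension. *)
Definition condition := forall N : structure L, (M -> N) -> set N.

Definition uniformly_definable (D : condition) :=
  exists p (chi : formula L p.+1) (d : p.-tuple M),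
    forall (N : structure L) (f : M -> N) c,
      D N f c <-> solutions chi (map_tuple f d) c.

Lemma uniform_solutions p (chi : formula L p.+1) (d : p.-tuple M) :
  uniformly_definable (fun N f => solutions chi (map_tuple f d)).
Proof. by exists p, chi, d. Qed.

Lemma uniform_setT : uniformly_definable (fun _ _ => setT).
Proof. by exists 0, (Eq (Var L ord0) (Var L ord0)), [tuple]. Qed.

Lemma uniform_setC (D : condition) :
  uniformly_definable D -> uniformly_definable (fun N f => ~` D N f).
Proof.
move=> [p [chi [d dP]]]; exists p, (Neg chi), d => N f c.
by rewrite /solutions /= /setC /= dP.
Qed.

(** The two defining formulas have their own parameter tuples. They are put side
by side, and the formulas renamed to read their half while sharing variable 0. *)
Lemma uniform_setI (D E : condition) :
    uniformly_definable D -> uniformly_definable E ->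
  uniformly_definable (fun N f => D N f `&` E N f).
Proof.
move=> [p [chi [d dP]]] [q [psi [e eP]]].
pose rl := rename_under (@lshift p q); pose rr := rename_under (@rshift p q).
exists (p + q), (And (rename chi rl) (rename psi rr)), [tuple of d ++ e].
move=> N f c; have -> : (D N f `&` E N f) c <-> D N f c /\ E N f c by [].
have left_part i : tnth (map_tuple f [tuple of d ++ e]) (lshift q i) =
    tnth (map_tuple f d) i by rewrite !tnth_map tnth_lshift.
have right_part i : tnth (map_tuple f [tuple of d ++ e]) (rshift p i) =
    tnth (map_tuple f e) i by rewrite !tnth_map tnth_rshift.
rewrite dP eP /solutions /=.
by rewrite (sat_rename_under chi c left_part) (sat_rename_under psi c right_part).
Qed.

Lemma uniform_bigcap n (D : nat -> condition) :
    (forall l, l < n -> uniformly_definable (D l)) ->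
  uniformly_definable (fun N f => [set c | forall l, l < n -> D l N f c]).
Proof.
elim: n => [|n IH] uD.
  have [p [chi [d dP]]] := uniform_setT.
  by exists p, chi, d => N f c; rewrite -dP.
have [p [chi [d dP]]] := uniform_setI (IH (fun l ln => uD l (ltnW ln))) (uD n (leqnn _)).
exists p, chi, d => N f c; rewrite -dP; split=> [Dc|[Dc Dn] l].
  by split=> [l ln|]; apply: Dc => //; exact: ltnW.
by rewrite ltnS leq_eqVlt => /orP[/eqP -> //|]; exact: Dc.
Qed.

Lemma map_tuple_idE n (d : n.-tuple M) : map_tuple id d = d.
Proof. by apply: eq_from_tnth => i; rewrite tnth_map. Qed.

(** Nonemptiness of a uniformly definable set is one existential formula with
parameters in [M], and elementary embeddings reflect it. *)
Lemma uniform_descent (D : condition) (N : structure L) (f : M -> N) :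
  uniformly_definable D -> elementary_embedding f -> D N f !=set0 -> D M id !=set0.
Proof.
move=> [p [chi [d dP]]] f_elem [c /dP Dc].
have [x xP] : sat (Ex chi) d by apply/f_elem; exists c.
exists x; apply/dP.
by rewrite map_tuple_idE.
Qed.

(** Only finitely many parameters are mentioned, so the requirements are a finite
conjunction, which descends to [M]. *)
Lemma ict_consistent_realized m (phi psi : formula L m.+1)
    (a b : nat -> m.-tuple M) (i j n : nat) :
    ict_consistent phi psi a b i j ->
  exists c : M, forall l, l < n ->
    (solutions phi (a l) c <-> l = i) /\ (solutions psi (b l) c <-> l = j).
Proof.
move=> [N [f [c [f_elem phic psic nphic npsic]]]].
pose cond (chi : formula L m.+1) (d : nat -> m.-tuple M) i l : condition :=
  if l == i then fun N f => solutions chi (map_tuple f (d l))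
  else fun N f => ~` solutions chi (map_tuple f (d l)).
have cond_uniform chi d k l : uniformly_definable (cond chi d k l).
  rewrite /cond; case: eqP => _; last apply: uniform_setC; exact: uniform_solutions.
have cond_iff chi d k l (N' : structure L) (g : M -> N') e : cond chi d k l N' g e <->
    (solutions chi (map_tuple g (d l)) e <-> l = k).
  rewrite /cond; case: eqP => [->|lk] /=; first by split=> // -> .
  by split=> [ne|ne] ; [split=> // /ne|move/ne].
have [] := uniform_descent (uniform_bigcap (n := n) (fun l _ =>
  uniform_setI (cond_uniform phi a i l) (cond_uniform psi b j l))) f_elem.
  exists c => l _; split; apply/cond_iff; split=> [|-> //].
    by move=> h; apply: contrapT => /nphic.
  by move=> h; apply: contrapT => /npsic.
move=> x xP; exists x => l /xP[/cond_iff + /cond_iff].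
by rewrite !map_tuple_idE.
Qed.

End UniformConditions.

(** * Ultraproducts and Los's theorem *)

Section Ultraproduct.
Variables (L : language) (I : Type) (U : set_system I).
Hypothesis ultraU : UltraFilter U.
Variable M : I -> structure L.

Let filterU : Filter U := ultra_proper.

Definition ae_eq (x y : forall k, M k) := U [set k | x k = y k].

Lemma ae_refl x : ae_eq x x.
Proof. by apply: filterS filterT => k _. Qed.

Lemma ae_class x y : ae_eq x y -> ae_eq x = ae_eq y.
Proof.
move=> xy; apply/funext => z; apply/propext.
by split; apply: filterS2 xy => k /= ->.
Qed.

(** A representative that depends only on the class of [x] for [ae_eq]. Formula
equality is interpreted by true equality, so the ultraproduct has to be an
actual quotient; it is realized as the set of the chosen representatives. *)
Definition repr (x : forall k, M k) : forall k, M k :=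
  sval (@cid _ (ae_eq x) (ex_intro _ x (ae_refl x))).

Lemma ae_repr x : ae_eq x (repr x).
Proof. exact: svalP (cid _). Qed.

Lemma repr_eq x y : ae_eq x y -> repr x = repr y.
Proof.
rewrite /repr => /ae_class; move: (ex_intro _ x _) (ex_intro _ y _) => + + xy.
by rewrite xy => h h'; rewrite (Prop_irrelevance h h').
Qed.

Definition ultra_carrier := {x : forall k, M k | repr x = x}.

Definition class (x : forall k, M k) : ultra_carrier :=
  exist _ (repr x) (esym (repr_eq (ae_repr x))).

Definition coord (k : I) (x : ultra_carrier) : M k := sval x k.

Lemma coord_class x : U [set k | coord k (class x) = x k].
Proof. by apply: filterS (ae_repr x) => k /= <-. Qed.

Lemma ultra_eq (x y : ultra_carrier) : U [set k | coord k x = coord k y] -> x = y.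
Proof.
case: x y => [x rx] [y ry] xy; apply: eq_exist.
by rewrite -rx -ry; exact: repr_eq.
Qed.

Lemma ultra_inhabited : inhabited ultra_carrier.
Proof.
constructor; apply: class => k.
by have /cid[] : exists x : M k, True by have [x] := carrier_inhabited (M k); exists x.
Qed.

Definition ultraproduct : structure L := {|
  carrier := ultra_carrier;
  carrier_inhabited := ultra_inhabited;
  interp_func n f v := class (fun k => interp_func f (map_tuple (coord k) v));
  interp_rel n R v := U [set k | interp_rel R (map_tuple (coord k) v)] |}.

Lemma eval_ultraproduct n (v : n.-tuple ultraproduct) (t : term L n) :
  U [set k | coord k (eval v t) = eval (map_tuple (coord k) v) t].
Proof.
elim: t => [i|p f ts IH] /=; first by apply: filterS filterT => k _; rewrite /= tnth_map.
pose value k := interp_func f (map_tuple (coord k) [tuple eval v (ts i) | i < p]).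
have := filter_forall filterU IH; apply: filterS2 (coord_class value) => k /= valueE ts_k; rewrite valueE.
by congr interp_func; apply: eq_from_tnth => i; rewrite tnth_map !tnth_mktuple.
Qed.

(** Negation is the step that uses that [U] is an ultrafilter; the existential
quantifier uses choice, to glue the witnesses of the coordinates. *)
Lemma Los n (phi : formula L n) (v : n.-tuple ultraproduct) :
  sat phi v <-> U [set k | sat phi (map_tuple (coord k) v)].
Proof.
have congrU (P Q : set I) : U [set k | P k <-> Q k] -> U P <-> U Q.
  by move=> PQ; split; apply: filterS2 PQ => k /= ->.
elim: phi v => {n} [n t u|n k R ts|n phi IH|n phi IHphi psi IHpsi|n phi IH] v /=.
- have tu : U [set k | coord k (eval v t) = coord k (eval v u)] <->
      U [set k | eval (map_tuple (coord k) v) t = eval (map_tuple (coord k) v) u].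
    apply: congrU; apply: filterS2 (eval_ultraproduct v t) (eval_ultraproduct v u).
    by move=> k /= -> ->.
  by rewrite -tu; split=> [->|/ultra_eq //]; apply: filterS filterT.
- apply: congrU.
  have := filter_forall filterU (fun i => eval_ultraproduct v (ts i)).
  apply: filterS => i /= ts_i.
  suff -> : map_tuple (coord i) [tuple eval v (ts j) | j < k] =
    [tuple eval (map_tuple (coord i) v) (ts j) | j < k] by [].
  by apply: eq_from_tnth => j; rewrite tnth_map !tnth_mktuple.
- rewrite IH; split=> [nU|UN UP].
    by have [] := in_ultra_setVsetC [set k | sat phi (map_tuple (coord k) v)] ultraU.
  by have [k []] := filter_ex (filterI UN UP).
- rewrite IHphi IHpsi; split=> [[]|UI]; first exact: filterS2.
  by split; apply: filterS UI => k [].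
- have cons_coord (x : ultraproduct) k : map_tuple (coord k) [tuple of x :: v] =
      [tuple of coord k x :: map_tuple (coord k) v] by exact: val_inj.
  split=> [[x /IH]|Uex].
    by apply: filterS => k /=; rewrite cons_coord; exists (coord k x).
  have witness k : exists y : M k,
      (exists x, sat phi [tuple of x :: map_tuple (coord k) v]) ->
      sat phi [tuple of y :: map_tuple (coord k) v].
    have [[x xP]|nx] := pselect (exists x, sat phi [tuple of x :: map_tuple (coord k) v]).
      by exists x.
    by have [x] := carrier_inhabited (M k); exists x.
  pose y k := sval (cid (witness k)); exists (class y); apply/IH.
  apply: filterS2 (coord_class y) Uex => k.
  rewrite /mkset => yk; rewrite cons_coord yk.
  exact: svalP (cid (witness k)).
Qed.

Definition class_tuple m (b : forall k, m.-tuple (M k)) : m.-tuple ultraproduct :=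
  [tuple class (fun k => tnth (b k) i) | i < m].

Lemma Los_class n (phi : formula L n) (b : forall k, n.-tuple (M k)) :
  sat phi (class_tuple b) <-> U [set k | sat phi (b k)].
Proof.
have bE : U [set k | map_tuple (coord k) (class_tuple b) = b k].
  have := filter_forall filterU (fun i => coord_class (fun k => tnth (b k) i)).
  apply: filterS => k bk; apply: eq_from_tnth => i.
  by rewrite tnth_map tnth_mktuple; exact: bk.
by rewrite Los; split; apply: filterS2 bE => k /= ->.
Qed.

Lemma Los_solutions m (phi : formula L m.+1) (b : forall k, m.-tuple (M k)) x :
  @solutions L ultraproduct m phi (class_tuple b) (class x) <->
    U [set k | solutions phi (b k) (x k)].
Proof.
rewrite -[X in _ <-> X](Los_class phi (fun k => [tuple of x k :: b k])).
suff -> : class_tuple (fun k => [tuple of x k :: b k]) =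
    [tuple of class x :: class_tuple b] by [].
apply: eq_from_tnth => i; rewrite tnth_mktuple.
case: (unliftP ord0 i) => [j|] ->.
  rewrite tnthS tnth_mktuple; congr class.
  by apply: functional_extensionality_dep => k; rewrite tnthS.
rewrite tnth0; congr class.
Qed.

Lemma Los_rel2 (R : rels L 2) x y :
  @interp_rel L ultraproduct 2 R [tuple class x; class y] <->
    U [set k | interp_rel R [tuple x k; y k]].
Proof.
have xyE : U [set k | map_tuple (coord k) [tuple class x; class y] = [tuple x k; y k]].
  apply: filterS2 (coord_class x) (coord_class y) => k xk yk.
  by apply: val_inj; congr [:: _; _].
by split; apply: filterS2 xyE => k /= ->.
Qed.

Lemma model_ultraproduct (T : theory L) :
  (forall k, model (M k) T) -> model ultraproduct T.
Proof.
move=> MT phi Tphi; apply/Los; apply: filterS filterT => k _ /=.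
by rewrite [map_tuple _ _]tuple0; exact: MT.
Qed.

End Ultraproduct.

(** * The uniform bound and dp-minimality *)

Section Main.
Variables (L : language) (lt : rels L 2) (T : theory L).
Hypothesis T_wom : weakly_ominimal_theory lt T.

Let ltM (M : structure L) (x y : M) := interp_rel lt [tuple x; y].

(** Compactness: weak o-minimality of one model bounds the drops of each definable
set, but not uniformly in the parameters. An ultraproduct of counterexamples to a uniform bound
would have a definable set with arbitrarily many drops. *)
Lemma uniform_drop_bound m (phi : formula L m.+1) :
  exists K, forall M : structure L, model M T -> forall (b : m.-tuple M) n,
    drops (@ltM M) (solutions phi b) n -> n <= K.
Proof.
apply: contrapT => unbounded.
(* One choice function provides, for each [K], a model with a parameter and the
   points of more than [K] drops. *)
pose bad (K : nat) (w : {M : structure L & (m.-tuple M * (nat -> M) * (nat -> M))%type}) :=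
  let: existT M (b, y, z) := w in [/\ model M T,
    forall s, s <= K ->
      [/\ solutions phi b (y s), ~ solutions phi b (z s) & ltM (y s) (z s)] &
    forall s t, s < t <= K -> ltM (z s) (y t)].
have /choice[w wP] : forall K, exists w, bad K w.
  move=> K; apply: contrapT => bounded; apply: unbounded; exists K => M MT b n.
  move=> [y [z [yz zy]]]; rewrite leqNgt; apply/negP => Kn; apply: bounded.
  exists (existT _ M (b, y, z)); split=> // [s sK|s t /andP[st tK]].
    by apply: yz; exact: leq_ltn_trans Kn.
  by apply: zy; rewrite st; exact: leq_ltn_trans Kn.
pose M K := projT1 (w K); pose b K : m.-tuple (M K) := (projT2 (w K)).1.1.
pose y K : nat -> M K := (projT2 (w K)).1.2; pose z K : nat -> M K := (projT2 (w K)).2.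
have {}wP K : [/\ model (M K) T,
    forall s, s <= K -> [/\ solutions phi (b K) (y K s),
      ~ solutions phi (b K) (z K s) & ltM (y K s) (z K s)] &
    forall s t, s < t <= K -> ltM (z K s) (y K t)].
  by rewrite /M /b /y /z; case: (w K) (wP K) => ? [[]].
have MT K : model (M K) T by have [] := wP K.
have [U [ultraU eventU]] := ultraFilterLemma eventually_filter.
pose N := ultraproduct ultraU M.
have NT : model N T by exact: model_ultraproduct.
have eventually_ge (s : nat) : U [set K | s <= K] by apply: eventU; exists s.
have [_ /(_ _ (ex_intro _ m (ex_intro _ phi (ex_intro _ (class_tuple ultraU b) erefl))))] := T_wom NT.
move=> [k [C [convC phiC]]].
(* Each single condition on the classes of the points holds at all but finitely
   many coordinates, so it holds in the ultraproduct. *)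
suff : drops (@ltM N) (\bigcup_i C i) k.+1 by move/(drops_union_of_convex convC); rewrite ltnn.
rewrite -phiC.
exists (fun s => class ultraU (fun K => y K s)), (fun s => class ultraU (fun K => z K s)).
split=> [s _|s t /andP[st _]].
  have yz : U [set K | [/\ solutions phi (b K) (y K s), ~ solutions phi (b K) (z K s)
      & ltM (y K s) (z K s)]].
    by apply: filterS (eventually_ge s) => K sK; have [_ + _] := wP K; apply.
  split; first by apply/Los_solutions; apply: filterS yz => K [].
    move/Los_solutions => nz.
    by have [K [[_ + _]]] := filter_ex (filterI yz nz).
  by apply/Los_rel2; apply: filterS yz => K [].
apply/Los_rel2; apply: filterS (eventually_ge t) => K tK.
by have [_ _] := wP K; apply; rewrite st.
Qed.

End Main.

Theorem theorem4p1 (L : language) (lt : rels L 2) (T : theory L)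
  (hT : weakly_ominimal_theory lt T) : dp_minimal T.
Proof.
move=> M MT [m [phi [psi [a [b pattern]]]]].
have [KA phiK] := uniform_drop_bound hT phi.
have [KB psiK] := uniform_drop_bound hT psi.
have [lt_order _] := hT M MT.
have /choice[c cP] i : exists ci : nat -> M, forall j l, l < (KA + KB).+2 ->
    (solutions phi (a l) (ci j) <-> l = i) /\ (solutions psi (b l) (ci j) <-> l = j).
  by have /choice[ci ciP] := fun j => ict_consistent_realized (KA + KB).+2 (pattern i j); exists ci.
apply: (no_large_grid lt_order (fun i => phiK M MT (a i)) (fun j => psiK M MT (b j)) (c := c)).
  by move=> i j l _ _ lN; have [] := cP i j l lN.
by move=> i j l _ _ lN; have [] := cP i j l lN.
Qed.
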